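(* Let $k_1,k_2>0$ and $\delta\in(0,1)$. Consider the closed-loop hybrid system with state $(\underline{\boldsymbol q},h)\in\underline{\mathcal S}\times\{-1,1\}$, $\underline{\boldsymbol q}=\eta+\boldsymbol\mu+\varepsilon(\eta'+\boldsymbol\mu')$, given by the flow $$\dot{\underline{\boldsymbol q}}=\tfrac12\,\underline{\boldsymbol q}\,\underline{\boldsymbol\omega},\qquad \dot h=0,\qquad\text{when } h\eta\ge-\delta,$$ and the jumps $$\underline{\boldsymbol q}^+=\underline{\boldsymbol q},\qquad h^+\in\overline{\operatorname{sgn}}(\eta),\qquad\text{when } h\eta\le-\delta,$$ with the control law $$\underline{\boldsymbol\omega}=-k_1h\,\boldsymbol\mu-\varepsilon\,k_2\,\eta\,\boldsymbol\mu'.$$ Then the equilibrium points of this closed-loop system are $\underline{\boldsymbol q}=\pm1$, and the set $\{\pm1\}$ is asymptotically stable.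
   Context: $\mathbb{H}$ denotes Hamilton's quaternions with imaginary units $\hat\imath,\hat\jmath,\hat k$, conjugate $\boldsymbol q^*$ and norm $\|\boldsymbol q\|=\sqrt{\boldsymbol q\boldsymbol q^*}$. Dual quaternions are $\boldsymbol q+\varepsilon\boldsymbol q'$ with $\boldsymbol q,\boldsymbol q'\in\mathbb{H}$, where $\varepsilon\ne0$ is a central symbol with $\varepsilon^2=0$. A dual quaternion is written $\underline{\boldsymbol q}=\eta+\boldsymbol\mu+\varepsilon(\eta'+\boldsymbol\mu')$ with $\eta,\eta'\in\mathbb{R}$ and $\boldsymbol\mu,\boldsymbol\mu'$ pure imaginary quaternions. The set of unit dual quaternions is $$\underline{\mathcal S}=\{\boldsymbol q+\varepsilon\boldsymbol q' : \|\boldsymbol q\|=1,\ \boldsymbol q\boldsymbol q'^*+\boldsymbol q'\boldsymbol q^*=0\},$$ a closed submanifold of $\mathbb{R}^8$ (it is the Lie group $\mathrm{Spin}(3)\ltimes\mathbb{R}^3$ under multiplication). The set-valued sign is $\overline{\operatorname{sgn}}(s)=\{1\}$ if $s>0$, $\{-1\}$ if $s<0$, $\{-1,1\}$ if $s=0$. Hybrid systems: a system with data $(C,F,D,G)$ is $\dot x\in F(x)$ for $x\in C$, $x^+\in G(x)$ for $x\in D$, where $x^+$ is the state after a jump. A solution is a function $x(t,j)$ on a hybrid time domain $\operatorname{dom}x\subset\mathbb{R}_{\ge0}\times\mathbb{N}$ (a union of intervals $[t_j,t_{j+1}]\times\{j\}$ with $0=t_0\le t_1\le\cdots$, the last of which,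 if any, may be half-open or unbounded). It is locally absolutely continuous in $t$ on each interval, and on each interval with nonempty interior it satisfies $x(t,j)\in C$ for all $t$ in the interior and $\dot x\in F(x)$ for almost every $t$. At each jump time, $x(t_{j+1},j)\in D$ and $x(t_{j+1},j+1)\in G(x(t_{j+1},j))$. A solution is complete if its domain is unbounded. Equilibrium points are the unit dual quaternions $\underline{\boldsymbol q}$ at which $\dot{\underline{\boldsymbol q}}=0$ in the closed-loop flow. The set $\{\pm1\}$ refers to the component $\underline{\boldsymbol q}$ of the state, i.e. to the compact set $\mathcal A=\{\pm1\}\times\{-1,1\}$ of states. A compact set $\mathcal A$ is asymptotically stable if it is - stable: for each $\epsilon>0$ there is $r>0$ such that every solution starting at distance at most $r$ from $\mathcal A$ stays within distance $\epsilon$ of $\mathcal A$ for all $(t,j)$ in its domain; and - attractive: there is a neighborhood of $\mathcal A$ from which each solution is bounded and the complete solutions converge to $\mathcal A$ as $t+j\to\infty$. *)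

(* Defs.v *)
From mathcomp Require Import all_boot all_order all_algebra.
From mathcomp Require Import all_classical all_reals all_analysis.

Set Implicit Arguments.
Unset Strict Implicit.
Unset Printing Implicit Defensive.

Import Order.TTheory GRing.Theory Num.Theory.
Import numFieldNormedType.Exports.

Local Open Scope classical_set_scope.
Local Open Scope ring_scope.

Section HybridSystems.
Context {R : realType} {X : normedModType R}.

Record hybrid_system := HybridSystem {
  flow_set : set X;
  flow_map : X -> set X;
  jump_set : set X;
  jump_map : X -> set X }.

(** [hybrid_pieces tau J] is the union of the [tau j, tau j.+1] x {j}, j < J. *)
Definition hybrid_pieces (tau : nat -> R) (J : set nat) : set (R * nat) :=
  [set p | J p.2 /\ tau p.2 <= p.1 <= tau p.2.+1].

(** The last interval of a finite union, if any, is a nonempty interval with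
    left endpoint [tau J], included; [b] is an arbitrary right bound (closed, open
    or infinite). *)
Definition hybrid_time_domain (E : set (R * nat)) : Prop :=
  exists tau : nat -> R,
    [/\ tau 0%N = 0, {homo tau : i j / (i <= j)%N >-> i <= j} &
        E = hybrid_pieces tau setT \/
        exists (J : nat) (b : itv_bound R),
          tau J \in Interval (BLeft (tau J)) b /\
          E = hybrid_pieces tau `I_J `|`
              [set p | p.2 = J /\ p.1 \in Interval (BLeft (tau J)) b]].

Definition time_slice (E : set (R * nat)) (j : nat) : set R :=
  [set t | E (t, j)].

Definition absolutely_continuous (a b : R) (f : R -> X) : Prop :=
  forall e : R, 0 < e -> exists2 d : R, 0 < d &
    forall (n : nat) (u v : 'I_n -> R),
      (forall i, a <= u i /\ u i <= v i /\ v i <= b) ->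
      trivIset setT (fun i => `]u i, v i[%classic) ->
      \sum_(i < n) (v i - u i) < d ->
      \sum_(i < n) `|f (v i) - f (u i)| < e.

Definition locally_absolutely_continuous (I : set R) (f : R -> X) : Prop :=
  forall a b : R, a <= b -> `[a, b] `<=` I -> absolutely_continuous a b f.

(** A hybrid arc is represented by its domain [E] and a total function [x]
    whose values outside [E] are irrelevant. In a hybrid time domain, (t, j)
    and (t, j+1) both belong to [E] exactly when t is the (j+1)-st jump time. *)
Definition is_solution (H : hybrid_system) (E : set (R * nat))
    (x : R -> nat -> X) : Prop :=
  [/\ hybrid_time_domain E,
      forall j, locally_absolutely_continuous (time_slice E j) (x ^~ j),
      forall j t, (time_slice E j)° t -> flow_set H (x t j),
      forall j, \forall t \ae lebesgue_measure,
        (time_slice E j)° t ->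
        exists2 v, flow_map H (x t j) v & is_derive t (1 : R) (x ^~ j) v &
      forall t j, E (t, j) -> E (t, j.+1) ->
        jump_set H (x t j) /\ jump_map H (x t j) (x t j.+1)].

Definition complete_domain (E : set (R * nat)) : Prop :=
  forall M : R, exists2 p, E p & M < p.1 + p.2%:R.

(** Stability is measured by a distance [d] on [X], which need not be the one
    induced by the norm of [X]. *)
Definition dist_set (d : X -> X -> R) (A : set X) (x : X) : R :=
  inf [set d x a | a in A].

Definition stable (d : X -> X -> R) (H : hybrid_system) (A : set X) : Prop :=
  forall e : R, 0 < e -> exists2 r : R, 0 < r &
    forall E x, is_solution H E x -> dist_set d A (x 0 0%N) <= r ->
      forall t j, E (t, j) -> dist_set d A (x t j) <= e.

Definition attractive (d : X -> X -> R) (H : hybrid_system) (A : set X) :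
    Prop :=
  exists2 U : set X, set_nbhs A U &
    forall E x, is_solution H E x -> U (x 0 0%N) ->
      bounded_set [set x p.1 p.2 | p in E] /\
      (complete_domain E ->
       forall e : R, 0 < e -> exists T : R,
         forall t j, E (t, j) -> T <= t + j%:R -> dist_set d A (x t j) <= e).

Definition asymptotically_stable (d : X -> X -> R) (H : hybrid_system)
    (A : set X) : Prop :=
  [/\ compact A, stable d H A & attractive d H A].

End HybridSystems.
Arguments hybrid_system {R} X.

Section DualQuaternions.
Context {R : realType}.

(** (a, b, c, d) stands for a + b i + c j + d k. *)
Definition quat : Type := (R * R * R * R)%type.

Definition qre (q : quat) : R := q.1.1.1.
Definition qim (q : quat) : quat := let: (_, b, c, d) := q in (0, b, c, d).
Definition quat1 : quat := (1, 0, 0, 0).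

Definition qmul (p q : quat) : quat :=
  let: (a, b, c, d) := p in
  let: (a', b', c', d') := q in
  (a * a' - b * b' - c * c' - d * d',
   a * b' + b * a' + c * d' - d * c',
   a * c' - b * d' + c * a' + d * b',
   a * d' + b * c' - c * b' + d * a').

Definition qconj (q : quat) : quat :=
  let: (a, b, c, d) := q in (a, - b, - c, - d).

(** [qmul q (qconj q)] is real. *)
Definition qnorm (q : quat) : R := Num.sqrt (qre (qmul q (qconj q))).

(** (q, q') stands for q + eps q'. *)
Definition dquat : Type := (quat * quat)%type.

Definition dqmul (p q : dquat) : dquat :=
  (qmul p.1 q.1, qmul p.1 q.2 + qmul p.2 q.1).

Definition dquat1 : dquat := (quat1, 0).

Definition unit_dquat : set dquat :=
  [set q | qnorm q.1 = 1 /\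
           qmul q.1 (qconj q.2) + qmul q.2 (qconj q.1) = 0].

End DualQuaternions.
Arguments quat R : clear implicits.
Arguments dquat R : clear implicits.

Section ClosedLoop.
Context {R : realType}.
Variables k1 k2 delta : R.

Definition sgn_set (s : R) : set R :=
  if 0 < s then [set 1] else if s < 0 then [set -1] else [set -1; 1].

(** The ambient space of the states (q, h). *)
Definition state : Type := (dquat R * R)%type.

Definition state_space : set state := unit_dquat `*` [set -1; 1].

(** The Euclidean distance of R^9; the norm of the normed module [state] is the
    maximum of the absolute values of the nine coordinates. *)
Definition state_dist (x y : state) : R :=
  Num.sqrt (qnorm (x.1.1 - y.1.1) ^+ 2 + qnorm (x.1.2 - y.1.2) ^+ 2
            + (x.2 - y.2) ^+ 2).

Definition control (q : dquat R) (h : R) : dquat R :=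
  (- (k1 * h) *: qim q.1, - (k2 * qre q.1) *: qim q.2).

Definition velocity (q : dquat R) (h : R) : dquat R :=
  2^-1 *: dqmul q (control q h).

Definition closed_loop : hybrid_system state :=
  {| flow_set := [set x | state_space x /\ x.2 * qre x.1.1 >= - delta];
     flow_map := fun x => [set (velocity x.1 x.2, 0)];
     jump_set := [set x | state_space x /\ x.2 * qre x.1.1 <= - delta];
     jump_map := fun x => [set x.1] `*` sgn_set (qre x.1.1) |}.

Definition equilibrium_points : set (dquat R) :=
  [set q | exists h : R, flow_set closed_loop (q, h) /\ velocity q h = 0].

End ClosedLoop.
Arguments state R : clear implicits.

(* Main.v *)
(** Along a flow arc the alignment [h * eta] is nondecreasing, and the dual energy
    [W = |q'|^2] satisfies [W' = - k2 eta^2 W] because [q] and [q'] are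
    orthogonal.  Since solutions are only absolutely continuous, both facts are
    integrated by means of: an absolutely continuous function whose derivative is
    nonpositive almost everywhere is nonincreasing.  A solution that starts with
    [|eta| > delta] jumps at most once, and only at its initial point, where a
    jump turns [h * eta] into [|eta|]; after that [1 - h * eta] and [W] decay like
    [1 / (1 + c t)].  As the squared distance to the equilibria is
    [2 - 2 |eta| + W], this gives both stability and attractivity. *)

Require Import Defs.
From mathcomp Require Import all_boot all_order all_algebra.
From mathcomp Require Import all_classical all_reals all_analysis.
From mathcomp Require Import measurable_realfun ring lra.

Set Implicit Arguments.
Unset Strict Implicit.
Unset Printing Implicit Defensive.

Import Order.TTheory GRing.Theory Num.Theory.
Import numFieldNormedType.Exports.
Local Open Scope classical_set_scope.
Local Open Scope ring_scope.

(** * Monotonicity of absolutely continuous functions from the sign of the derivative almost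
    everywhere *)

Section AbsoluteContinuity.
Context {R : realType}.
Implicit Types (f g : R -> R) (a b : R).

(** Lengths of disjoint intervals add up to the measure of their union. Hence a family inside an
    open set of measure below [d] meets the smallness condition of absolute continuity. *)
Lemma sum_length_le_open (U : set R) n (u v : 'I_n -> R) :
  open U -> (forall i, u i <= v i) -> (forall i, `]u i, v i[ `<=` U) ->
  trivIset setT (fun i => `]u i, v i[%classic) ->
  ((\sum_(i < n) (v i - u i))%:E <= lebesgue_measure U)%E.
Proof.
move=> oU uv uvU tuv.
rewrite -sumEFin (eq_bigr (fun i => lebesgue_measure `]u i, v i[%classic)).
  rewrite -measure_bigsetU_ord //.
  apply: le_measure; rewrite ?inE; first exact: bigsetU_measurable.
    exact: open_measurable.
  apply: (big_ind (fun A => A `<=` U)) => [//|A B AU BU|i _]; last exact: uvU.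
  by rewrite subUset.
move=> i _; rewrite lebesgue_measure_itv /= lte_fin.
by case: ltgtP (uv i) => // -> _; rewrite subrr.
Qed.

(** Continuous induction along [[a, b]]: the exceptional null set is covered by an open set of small
    measure, where absolute continuity bounds the variation; at the other points the derivative
    bounds the local growth by an arbitrarily small slope. *)
Lemma absolutely_continuous_nonincreasing f a b :
  a <= b -> absolutely_continuous a b f ->
  (\forall t \ae lebesgue_measure,
     a < t < b -> exists2 v, is_derive t (1 : R) f v & v <= 0) ->
  f b <= f a.
Proof.
move=> ab acf [N [mN N0 badN]].
apply/ler_addgt0Pr => eps eps0.
(* Slope [e] over [[a, b]] and variation [e] inside the cover add up to [eps]. *)
pose e := eps / (b - a + 1).
have ba1 : 0 < b - a + 1 by lra.
have e0 : 0 < e by rewrite divr_gt0.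
have epsE : eps = e * (b - a) + e.
  by rewrite -[in RHS](mulr1 e) -mulrA mul1r -mulrDr /e divfK // gt_eqF.
have [d d0 acd] := acf _ e0.
(* With the endpoints adjoined, a point of [[a, b]] outside the cover is interior, so the derivative
   hypothesis applies to it. *)
pose N' : set R := N `|` [set a] `|` [set b].
have mN' : measurable N' by apply: measurableU => //; apply: measurableU.
have N'0 : lebesgue_measure N' = 0%E.
  have null1 (x : R) : lebesgue_measure.-negligible [set x].
    by apply/negligibleP => //; exact: lebesgue_measure_set1.
  by apply/negligibleP => //; do 2?[apply: negligibleU] => //; apply/negligibleP.
have [U [oU N'U muU]] : exists U : set R,
    [/\ open U, N' `<=` U & (lebesgue_measure U < d%:E)%E].
  have [||U [oU N'U muU]] := @lebesgue_regularity_outer R _ d mN'.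
  - by rewrite [ltLHS]N'0.
  - exact: d0.
  exists U; split => //; apply: le_lt_trans muU.
  have mU : measurable U by exact: open_measurable.
  rewrite -{1}(setDUK N'U); apply: (le_trans (measureU2 _ _ _)) => //.
    exact: measurableD.
  by rewrite [X in (X + _)%E]N'0 add0e.
(* [P t]: on [a, t], f grows with slope at most e, except on finitely many
   intervals inside U, whose contribution absolute continuity makes small. *)
pose P t := a <= t <= b /\ exists n (u v : 'I_n -> R),
  [/\ forall i, a <= u i /\ u i <= v i /\ v i <= t,
      trivIset setT (fun i => `]u i, v i[%classic),
      forall i, `]u i, v i[ `<=` U &
      f t <= f a + e * (t - a) + \sum_(i < n) `|f (v i) - f (u i)|].
(* The interval []s, t[] joins the family at index [ord0]; it is disjoint from the others, which all
   end by [s]. *)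
have extU s t : P s -> s <= t <= b -> `[s, t] `<=` U -> P t.
  move=> [/andP[as_ sb] [n [u [v [uv tuv uvU fs]]]]] /andP[st tb] stU.
  split; first by rewrite tb (le_trans as_).
  exists n.+1, (fun i => oapp u s (unlift ord0 i)),
    (fun i => oapp v t (unlift ord0 i)); split.
  - move=> i; case: unliftP => [j|] _ /=; last by [].
    by have [? [? ?]] := uv j; do 2?split => //; apply: le_trans st.
  - apply/trivIsetP => i j _ _.
    case: (unliftP ord0 i) => [i' ->|->];
    case: (unliftP ord0 j) => [j' ->|->] ij /=.
    + by move/trivIsetP : tuv; apply => //; apply: contra_neq ij => ->.
    + apply/seteqP; split => // x [] /=; rewrite !in_itv /=.
      by have [_ [_ ?]] := uv i'; lra.
    + apply/seteqP; split => // x [] /=; rewrite !in_itv /=.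
      by have [_ [_ ?]] := uv j'; lra.
    + by rewrite eqxx in ij.
  - move=> i; case: unliftP => [j|] _ /=; first exact: uvU.
    by apply: subset_trans stU; apply: subset_itv; rewrite bnd_simp.
  - rewrite big_ord_recl unlift_none /=.
    under eq_bigr do rewrite liftK /=.
    have : 0 <= e * (t - s) by rewrite mulr_ge0 ?subr_ge0 // ltW.
    have : f t - f s <= `|f t - f s| by exact: ler_norm.
    move: fs; rewrite !mulrBr; lra.
have extd s t : P s -> s <= t <= b -> f t - f s <= e * (t - s) -> P t.
  move=> [/andP[as_ sb] [n [u [v [uv tuv uvU fs]]]]] /andP[st tb] fts.
  split; first by rewrite tb (le_trans as_).
  exists n, u, v; split => //.
    by move=> i; have [? [? ?]] := uv i; do 2?split => //; apply: le_trans st.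
  by move: fs fts; rewrite !mulrBr; lra.
have Pa : P a.
  split; first by rewrite lexx.
  exists 0%N, (fun=> 0), (fun=> 0); split; [by case|by case|by case|].
  by rewrite big_ord0 subrr mulr0 !addr0.
suff [_ [n [u [v [uv tuv uvU fb]]]]] : P b.
  have : \sum_(i < n) `|f (v i) - f (u i)| < e.
    apply: acd => //; rewrite -lte_fin; apply: le_lt_trans muU.
    by apply: sum_length_le_open => // i; have [_ []] := uv i.
  by rewrite epsE; lra.
have supP : has_sup P.
  by split; [exists a|exists b => t [/andP[]]].
pose c := sup P.
have ac : a <= c by apply: sup_upper_bound.
have cb : c <= b by apply: ge_sup; [exists a | move=> t [/andP[]]].
(* Some [s] satisfying [P] lies within [r] below the supremum [c]; stepping across [c] reaches the
   minimum of [c + r / 2] and [b]. That point cannot exceed [c], so it is [b]. *)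
suff [r r0 step] : exists2 r, 0 < r & forall s t,
    P s -> c - r < s -> s <= c -> c <= t -> t < c + r -> t <= b -> P t.
  have [s Ps cs] := sup_adherent r0 supP.
  have sc : s <= c by apply: sup_upper_bound.
  pose t := Num.min (c + r / 2) b.
  have tb : t <= b by rewrite ge_min lexx orbT.
  have ct : c <= t by rewrite le_min cb andbT; lra.
  have Pt : P t.
    by apply: (step s) => //; rewrite gt_min; apply/orP; left; lra.
  have tc : t <= c by apply: sup_upper_bound.
  have [ltb|] := ltP (c + r / 2) b; last by move=> bt; rewrite -(min_idPr bt).
  by exfalso; move: tc; rewrite /t (min_idPl (ltW ltb)); lra.
(* If [c] is in [U], so is a neighbourhood and [extU] applies. Otherwise [f] has a nonpositive
   derivative at [c], the slopes from [c] to nearby points are at most [e], and [extd] applies. *)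
have [Uc|nUc] := pselect (U c).
  have [r /= r0 rU] := oU _ Uc.
  exists r => // s t Ps crs sc ct tcr tb.
  apply: extU Ps _ _; first by rewrite tb (le_trans sc).
  move=> x /=; rewrite in_itv /= => /andP[sx xt]; apply: rU.
  by rewrite /ball/= ltr_norml; lra.
have [v [dv <-] v0] : exists2 v, is_derive c (1 : R) f v & v <= 0.
  have : ~ N c by move=> Nc; apply: nUc; apply: N'U; left; left.
  have ca : c != a by apply: contra_notN nUc => /eqP ->; apply: N'U; left; right.
  have cb' : c != b by apply: contra_notN nUc => /eqP ->; apply: N'U; right.
  move=> Nc; have /contrapT : ~ ~ (a < c < b ->
      exists2 v, is_derive c (1 : R) f v & v <= 0).
    by move=> /badN.
  by apply; rewrite !lt_neqAle ac cb eq_sym ca cb'.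
move: dv v0; rewrite /derivable /derive => /[swap] v0.
move=> /cvgrPdist_lt /(_ _ e0)/=; rewrite near_withinE => -[r /= r0 dr].
move: v0 dr; set l := lim _ => v0 dr.
have slope x : x != c -> `|x - c| < r -> (x - c)^-1 * (f x - f c) <= e.
  move=> xc xr; have := dr (x - c); rewrite /= /ball/= sub0r normrN subr_eq0.
  move=> /(_ xr xc); rewrite [_%:A]mulr1 subrK -[_ *: _]/(_ * _) ltr_norml.
  lra.
have up x : c <= x -> x < c + r -> f x - f c <= e * (x - c).
  rewrite le_eqVlt => /predU1P[<-|cx] xr; first by rewrite !subrr mulr0.
  have := slope x; rewrite gt_eqF // gtr0_norm ?subr_gt0 // ltrBlDl.
  by move=> /(_ isT xr); rewrite ler_pdivrMl ?subr_gt0 // mulrC.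
have dn x : x <= c -> c - r < x -> f c - f x <= e * (c - x).
  rewrite le_eqVlt => /predU1P[->|xc] xr; first by rewrite !subrr mulr0.
  have := slope x; rewrite lt_eqF // ltr0_norm ?subr_lt0 // opprB ltrBlDr.
  have xr' : c < r + x by lra.
  move=> /(_ isT xr'); rewrite ler_ndivrMl ?subr_lt0 // => h.
  by rewrite -lerN2 opprB -mulrN opprB mulrC.
exists r => // s t Ps crs sc ct tcr tb.
apply: (extd s) => //; first by rewrite tb (le_trans sc).
by move: (up t ct tcr) (dn s sc crs); rewrite !mulrBr; lra.
Qed.

End AbsoluteContinuity.

(** * Closure properties of absolute continuity and a decay estimate *)

Section AbsoluteContinuityClosure.
Context {R : realType}.
Implicit Types (f g : R -> R) (a b c : R).

Lemma ae_imply (P Q : R -> Prop) : (forall t, P t -> Q t) ->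
  (\forall t \ae lebesgue_measure, P t) ->
  (\forall t \ae lebesgue_measure, Q t).
Proof.
move=> PQ [N [mN N0 PN]]; exists N; split => //.
by apply: subset_trans PN => t /= nQ /PQ.
Qed.

Lemma absolutely_continuous_le {X Y : normedModType R} a b
    (x : R -> X) (y : R -> Y) :
  (forall u v, `|y v - y u| <= `|x v - x u|) ->
  absolutely_continuous a b x -> absolutely_continuous a b y.
Proof.
move=> yx acx e /acx[d d0 acd]; exists d => // n u v uv tuv suv.
by apply: le_lt_trans (acd n u v uv tuv suv); apply: ler_sum.
Qed.

Lemma absolutely_continuous_sub {X : normedModType R} a b a' b' (x : R -> X) :
  a <= a' -> b' <= b ->
  absolutely_continuous a b x -> absolutely_continuous a' b' x.
Proof.
move=> aa' bb' acx e /acx[d d0 acd]; exists d => // n u v uv.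
apply: acd => i; have [? [? ?]] := uv i.
by split; [exact: le_trans aa' _|split => //; exact: le_trans bb'].
Qed.

(** The one-interval case, which is uniform continuity on [[a, b]]. *)
Lemma absolutely_continuousP1 {X : normedModType R} a b (x : R -> X) :
  absolutely_continuous a b x -> forall e, 0 < e -> exists2 d, 0 < d &
    forall u v, a <= u -> u <= v -> v <= b -> v - u < d -> `|x v - x u| < e.
Proof.
move=> acx e /acx[d d0 acd]; exists d => // u v au uv vb uvd.
have := acd 1%N (fun=> u) (fun=> v); rewrite !big_ord1; apply => //.
by apply/trivIsetP => i j _ _; rewrite !ord1 eqxx.
Qed.

(** By uniform continuity [f] moves by less than 1 over a step of length [d / 2], and finitely many
    such steps cover [[a, b]]. *)
Lemma absolutely_continuous_bounded f a b :
  absolutely_continuous a b f ->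
  exists2 M, 0 < M & forall t, a <= t <= b -> `|f t| <= M.
Proof.
move=> /absolutely_continuousP1 /(_ _ ltr01)[d d0 fd].
have bnd k : forall t, a <= t <= b -> t <= a + k%:R * (d / 2) ->
    `|f t| <= `|f a| + k%:R.
  elim: k => [|k IH] t /andP[at_ tb] tk.
    have -> : t = a by apply/eqP; rewrite eq_le at_ andbT; lra.
    by rewrite addr0.
  pose s := Num.max a (t - d / 2).
  have as_ : a <= s by rewrite le_max lexx.
  have ts : t - d / 2 <= s by rewrite le_max lexx orbT.
  have st : s <= t by rewrite ge_max at_ /=; lra.
  have dk : 0 <= k%:R * (d / 2) by rewrite mulr_ge0 // divr_ge0 // ltW.
  have sk : s <= a + k%:R * (d / 2).
    by move: tk; rewrite -natr1 mulrDl ge_max => ?; apply/andP; split; lra.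
  have sab : a <= s <= b by rewrite as_ (le_trans st).
  have tsd : t - s < d by lra.
  have := IH s sab sk; have := fd s t as_ st tb tsd.
  by have := ler_normD (f t - f s) (f s); rewrite subrK -natr1; lra.
have d20 : 0 < d / 2 by rewrite divr_gt0.
pose k := Num.bound (`|b - a| / (d / 2)).
exists (`|f a| + k%:R + 1) => [|t tab].
  by rewrite ltr_wpDl // addr_ge0.
suff /(bnd k t tab) : t <= a + k%:R * (d / 2) by lra.
have : `|b - a| / (d / 2) < k%:R by apply: archi_boundP; rewrite divr_ge0 // ltW.
rewrite ltr_pdivrMr // => bk; have := ler_norm (b - a).
by move: tab => /andP[]; lra.
Qed.

Lemma absolutely_continuous_lipschitz f a b k :
  (forall u v, u <= v -> `|f v - f u| <= k * (v - u)) ->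
  absolutely_continuous a b f.
Proof.
move=> fk e e0; have k1 : 0 < `|k| + 1 by rewrite ltr_wpDl.
(* Adding 1 keeps the divisor positive when [k] is 0, as for constants. *)
exists (e / (`|k| + 1)); first by rewrite divr_gt0.
move=> n u v uv _; rewrite ltr_pdivlMr // mulrC mulr_sumr; apply: le_lt_trans.
apply: ler_sum => i _; have [_ [uvi _]] := uv i.
apply: (le_trans (fk _ _ uvi)); rewrite ler_wpM2r ?subr_ge0 //.
by have := ler_norm k; lra.
Qed.

Lemma absolutely_continuousD f g a b :
  absolutely_continuous a b f -> absolutely_continuous a b g ->
  absolutely_continuous a b (f + g).
Proof.
move=> acf acg e e0; have e20 : 0 < e / 2 by rewrite divr_gt0.
have [d1 d10 fd] := acf _ e20; have [d2 d20 gd] := acg _ e20.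
exists (Num.min d1 d2); first by rewrite lt_min d10.
move=> n u v uv tuv; rewrite lt_min => /andP[uvd1 uvd2].
have := fd n u v uv tuv uvd1; have := gd n u v uv tuv uvd2.
suff : \sum_(i < n) `|(f + g) (v i) - (f + g) (u i)| <=
    \sum_(i < n) `|f (v i) - f (u i)| + \sum_(i < n) `|g (v i) - g (u i)| by lra.
rewrite -big_split /=; apply: ler_sum => i _.
by rewrite -[(f + g) _]/(_ + _) -[(f + g) (u i)]/(_ + _) opprD addrACA ler_normD.
Qed.

(** An increment of the product splits into an increment of each factor times a value of the other,
    and both factors are bounded on [[a, b]]. *)
Lemma absolutely_continuousM f g a b :
  absolutely_continuous a b f -> absolutely_continuous a b g ->
  absolutely_continuous a b (f * g).
Proof.
move=> acf acg e e0.
have [M M0 fM] := absolutely_continuous_bounded acf.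
have [N N0 gN] := absolutely_continuous_bounded acg.
have eN : 0 < e / 2 / N by rewrite !divr_gt0.
have eM : 0 < e / 2 / M by rewrite !divr_gt0.
have [d1 d10 fd] := acf _ eN; have [d2 d20 gd] := acg _ eM.
exists (Num.min d1 d2); first by rewrite lt_min d10.
move=> n u v uv tuv; rewrite lt_min => /andP[uvd1 uvd2].
have := fd n u v uv tuv uvd1; have := gd n u v uv tuv uvd2.
rewrite (ltr_pdivlMr _ _ M0) (ltr_pdivlMr _ _ N0) !mulr_suml => ge fe.
rewrite (splitr e); apply: le_lt_trans (ltrD fe ge).
rewrite -big_split /=; apply: ler_sum => i _; have [aui [uvi vib]] := uv i.
rewrite -[(f * g) _]/(_ * _) -[(f * g) (u i)]/(_ * _).
have -> : f (v i) * g (v i) - f (u i) * g (u i) =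
  (f (v i) - f (u i)) * g (u i) + (g (v i) - g (u i)) * f (v i) by ring.
apply: (le_trans (ler_normD _ _)); rewrite !normrM lerD // ler_wpM2l //.
  by apply: gN; rewrite aui (le_trans uvi).
by apply: fM; rewrite vib (le_trans aui).
Qed.

Lemma absolutely_continuous_cst c a b : absolutely_continuous a b (cst c : R -> R).
Proof.
apply: (@absolutely_continuous_lipschitz _ _ _ 0) => u v _.
by rewrite subrr normr0 mul0r.
Qed.

Lemma absolutely_continuousN f a b :
  absolutely_continuous a b f -> absolutely_continuous a b (- f).
Proof.
by apply: absolutely_continuous_le => u v; rewrite -opprD normrN.
Qed.

(** Continuity carries the sign to the endpoints. This serves to extend the flow-set conditions,
    which a solution satisfies only at interior times. *)
Lemma absolutely_continuous_endpoint_ge0 f a b :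
  a < b -> absolutely_continuous a b f ->
  (forall t, a < t < b -> 0 <= f t) -> 0 <= f a /\ 0 <= f b.
Proof.
move=> ab /absolutely_continuousP1 acf f0.
have [t0 [at0 t0b]] : exists t, a < t /\ t < b by exists ((a + b) / 2); lra.
split; rewrite leNgt; apply/negP => fl0.
- have fl : 0 < - f a by rewrite oppr_gt0.
  have [d d0 fd] := acf _ fl.
  pose t := Num.min t0 (a + d / 2).
  have at_ : a < t by rewrite lt_min at0 /=; lra.
  have tt0 : t <= t0 by rewrite ge_min lexx.
  have td : t <= a + d / 2 by rewrite ge_min lexx orbT.
  have /f0 : a < t < b by rewrite at_ (le_lt_trans tt0).
  have := fd a t (lexx _) (ltW at_) (ltW (le_lt_trans tt0 t0b)).
  by rewrite ltr_norml; lra.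
- have fl : 0 < - f b by rewrite oppr_gt0.
  have [d d0 fd] := acf _ fl.
  pose t := Num.max t0 (b - d / 2).
  have tb : t < b by rewrite gt_max t0b /=; lra.
  have tt0 : t0 <= t by rewrite le_max lexx.
  have td : b - d / 2 <= t by rewrite le_max lexx orbT.
  have /f0 : a < t < b by rewrite tb (lt_le_trans at0).
  have := fd t b (ltW (lt_le_trans at0 tt0)) (ltW tb) (lexx _).
  by rewrite ltr_norml; lra.
Qed.

(* Comparing f with its final value f b, which bounds it from below, avoids the
   exponential. *)
Lemma absolutely_continuous_decay f (c a b : R) :
  a <= b -> 0 <= c -> absolutely_continuous a b f ->
  (forall t, a < t <= b -> 0 <= f t) ->
  (\forall t \ae lebesgue_measure,
     a < t < b -> exists2 v, is_derive t (1 : R) f v & v <= - (c * f t)) ->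
  f b * (1 + c * (b - a)) <= f a.
Proof.
move=> ab c0 acf f0 df.
have mono t : a < t <= b -> f b <= f t.
  move=> /andP[at_ tb].
  apply: absolutely_continuous_nonincreasing => //.
    by apply: absolutely_continuous_sub acf => //; exact: ltW.
  apply: ae_imply df => s + /andP[ts sb].
  have as_ : a < s by exact: lt_trans at_ ts.
  rewrite as_ sb => /(_ isT)[v dv vc]; exists v => //.
  apply: (le_trans vc); rewrite oppr_le0 mulr_ge0 // f0 // as_ /= ltW //.
have [->|anb] := eqVneq a b; first by rewrite subrr mulr0 addr0 mulr1.
have ab' : a < b by rewrite lt_neqAle anb.
(* Since [f b <= f t], the linear term adds at most [c * f t] to the derivative, so [g] is
   nonincreasing; [g b <= g a] is the claim rearranged. *)
pose g := f + (fun t => c * f b * (t - a)).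
suff : g b <= g a.
  by rewrite /g -[(f + _) b]/(_ + _) -[(f + _) a]/(_ + _) subrr; lra.
apply: absolutely_continuous_nonincreasing => //.
  apply: absolutely_continuousD => //.
  apply: (@absolutely_continuous_lipschitz _ _ _ (c * f b)) => u v uv.
  rewrite -mulrBr normrM ger0_norm ?mulr_ge0 ?f0 ?ab' //=.
  by rewrite opprB addrA subrK ger0_norm // subr_ge0.
apply: ae_imply df => t + tab => /(_ tab)[v dv vc].
exists (v + c * f b).
  apply: is_deriveD.
  have -> : (fun t => c * f b * (t - a)) = (c * f b) *: (id - cst a).
    by apply/funext.
  apply: is_derive_eq; by rewrite subr0 [_%:A]mulr1.
have : c * f b <= c * f t.
  by rewrite ler_wpM2l // mono //; case/andP: tab => -> /ltW.
lra.
Qed.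

End AbsoluteContinuityClosure.

(** * Structure of hybrid time domains *)

Section HybridTimeDomain.
Context {R : realType}.
Variable E : set (R * nat).
Hypothesis domE : hybrid_time_domain E.

Lemma hybrid_time_domain0 : E (0, 0%N).
Proof.
have [tau [t0 tauh [->|[J [b [tJ ->]]]]]] := domE.
  by split => //=; rewrite t0 lexx -t0 tauh.
case: J tJ => [|J] tJ; first by right; split => //=; move: tJ; rewrite t0.
by left; split => //=; rewrite t0 lexx -t0 tauh.
Qed.

Lemma hybrid_time_domain_convex s t u j :
  E (s, j) -> E (t, j) -> s <= u <= t -> E (u, j).
Proof.
have [tau [_ _ [->|[J [b [_ ->]]]]]] := domE.
  move=> [_ /andP[/= js _]] [_ /andP[/= _ tj]] /andP[su ut].
  by split => //=; rewrite (le_trans js su) (le_trans ut tj).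
move=> [[/= jJ /andP[js _]]|[/= -> sI]].
  move=> [[_ /andP[/= _ tj]]|[/= jJ']] /andP[su ut].
    by left; split => //=; rewrite (le_trans js su) (le_trans ut tj).
  by move: jJ; rewrite /= jJ' ltnn.
move=> [[/= +]|[_ tI] sut]; first by rewrite ltnn.
by right; split => //; exact: interval_is_interval sI tI _ sut.
Qed.

(** The witness is the jump time [tau j.+1], where slice [j] ends and slice [j.+1] begins, also when
    the latter is the last interval. *)
Lemma hybrid_time_domain_jump t j :
  E (t, j.+1) -> exists s, [/\ s <= t, E (s, j) & E (s, j.+1)].
Proof.
have [tau [_ tauh [->|[J [b [tJ ->]]]]]] := domE => tE; exists (tau j.+1).
  by case: tE => _ /andP[/= jt _]; split => //; split => //=; rewrite lexx tauh.
case: tE => [[/= jJ /andP[jt _]]|[/= jJ tb]].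
  split => //; first by left; split => /=; [exact: ltnW|rewrite lexx tauh].
  by left; split => //=; rewrite lexx tauh.
rewrite jJ; split; first by move: tb; rewrite itv_boundlr => /andP[].
  by left; split; rewrite /= -jJ // lexx tauh.
by right.
Qed.

(** Each point is reached from the origin by flows within slices and jumps between them, so an
    invariant of solutions need only be checked at the start, along flows and at jumps. *)
Lemma hybrid_time_domain_ind (Q : R -> nat -> Prop) :
  Q 0 0%N ->
  (forall s t j, E (s, j) -> E (t, j) -> s < t -> Q s j -> Q t j) ->
  (forall t j, E (t, j) -> E (t, j.+1) -> Q t j -> Q t j.+1) ->
  forall t j, E (t, j) -> Q t j.
Proof.
move=> Q0 Qflow Qjump t j; elim: j t => [|j IH] t Et.
  have t0 : 0 <= t.
    have [tau [t0 _ [EE|[[|J] [b [_ EE]]]]]] := domE; move: Et; rewrite EE.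
    - by case=> _ /=; rewrite t0 => /andP[].
    - by case=> [[]//|[_ /=]]; rewrite t0 itv_boundlr => /andP[].
    - by case=> [[_ /=]|[]//]; rewrite t0 => /andP[].
  move: t0; rewrite le_eqVlt => /predU1P[<- //|t0].
  by apply: Qflow t0 Q0; [exact: hybrid_time_domain0|].
have [s [st Es Esj]] := hybrid_time_domain_jump Et.
have Qs : Q s j.+1 by apply: Qjump Es Esj (IH _ Es).
by move: st; rewrite le_eqVlt => /predU1P[<- //|st]; apply: Qflow st Qs.
Qed.

End HybridTimeDomain.

(** * Coordinates of differentiable and absolutely continuous curves *)

Section DeriveCoordinates.
Context {R : realType}.

(** By linearity the difference quotient of [p \o f] is [p] applied to that of [f], and it converges
    by continuity of [p] at [v]. *)
Lemma is_derive_comp_cvg {V W : normedModType R} (p : V -> W) (f : R -> V) t v :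
  (forall u w, p (u - w) = p u - p w) -> (forall (k : R) u, p (k *: u) = k *: p u) ->
  {for v, continuous p} ->
  is_derive t (1 : R) f v -> is_derive t (1 : R) (p \o f) (p v).
Proof.
move=> pB pZ pv [df dfv].
have pc : (h^-1 *: ((p \o f \o shift t) h%:A - p (f t))) @[h --> 0^'] --> p v.
  rewrite (_ : (fun h => _) = p \o (fun h => h^-1 *: ((f \o shift t) h%:A - f t))).
    by apply: continuous_cvg => //; rewrite -dfv.
  by apply/funext => h /=; rewrite pZ pB.
by split; [apply/cvg_ex; exists (p v)|apply/cvg_lim].
Qed.

Lemma is_derive_fst {V W : normedModType R} (f : R -> V * W) t v :
  is_derive t (1 : R) f v -> is_derive t (1 : R) (fun s => (f s).1) v.1.
Proof. by apply: is_derive_comp_cvg => //; exact: cvg_fst. Qed.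

Lemma is_derive_snd {V W : normedModType R} (f : R -> V * W) t v :
  is_derive t (1 : R) f v -> is_derive t (1 : R) (fun s => (f s).2) v.2.
Proof. by apply: is_derive_comp_cvg => //; exact: cvg_snd. Qed.

End DeriveCoordinates.

Section AbsoluteContinuityCoordinates.
Context {R : realType} {V W : normedModType R}.

Lemma absolutely_continuous_fst (f : R -> V * W) a b :
  absolutely_continuous a b f -> absolutely_continuous a b (fun s => (f s).1).
Proof.
by apply: absolutely_continuous_le => u v; rewrite prod_normE le_max lexx.
Qed.

Lemma absolutely_continuous_snd (f : R -> V * W) a b :
  absolutely_continuous a b f -> absolutely_continuous a b (fun s => (f s).2).
Proof.
by apply: absolutely_continuous_le => u v; rewrite prod_normE le_max lexx orbT.
Qed.

End AbsoluteContinuityCoordinates.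

(** * Euclidean inner product of quaternions *)

Section QuaternionDot.
Context {R : realType}.
Implicit Types p q : quat R.

(** This is the real part of [qmul p (qconj q)]. *)
Definition qdot p q : R :=
  let: (a, b, c, d) := p in
  let: (a', b', c', d') := q in
  a * a' + b * b' + c * c' + d * d'.

Lemma qdotE p q : qdot p q =
  p.1.1.1 * q.1.1.1 + p.1.1.2 * q.1.1.2 + p.1.2 * q.1.2 + p.2 * q.2.
Proof. by case: p => [[[? ?] ?] ?]; case: q => [[[? ?] ?] ?]. Qed.

Lemma qdot_ge0 q : 0 <= qdot q q.
Proof. by rewrite qdotE !addr_ge0 // -expr2 sqr_ge0. Qed.

Lemma qnorm_sqr q : qnorm q ^+ 2 = qdot q q.
Proof.
rewrite /qnorm sqr_sqrtr; case: q => [[[a b] c] d] /=; rewrite /qre /=; first ring.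
by rewrite !mulrN !opprK !addr_ge0 // -expr2 sqr_ge0.
Qed.

Lemma absolutely_continuous_qdot (p q : R -> quat R) a b :
  absolutely_continuous a b p -> absolutely_continuous a b q ->
  absolutely_continuous a b (fun t => qdot (p t) (q t)).
Proof.
move=> acp acq; rewrite (_ : (fun _ => _) =
   (fun t => (p t).1.1.1) * (fun t => (q t).1.1.1) +
   (fun t => (p t).1.1.2) * (fun t => (q t).1.1.2) +
   (fun t => (p t).1.2) * (fun t => (q t).1.2) +
   (fun t => (p t).2) * (fun t => (q t).2)).
  have acp1 := absolutely_continuous_fst acp.
  have acp11 := absolutely_continuous_fst acp1.
  have acq1 := absolutely_continuous_fst acq.
  have acq11 := absolutely_continuous_fst acq1.
  apply: absolutely_continuousD;
    [apply: absolutely_continuousD; [apply: absolutely_continuousD|]|];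
    apply: absolutely_continuousM.
  - exact: absolutely_continuous_fst acp11.
  - exact: absolutely_continuous_fst acq11.
  - exact: absolutely_continuous_snd acp11.
  - exact: absolutely_continuous_snd acq11.
  - exact: absolutely_continuous_snd acp1.
  - exact: absolutely_continuous_snd acq1.
  - exact: absolutely_continuous_snd acp.
  - exact: absolutely_continuous_snd acq.
by apply/funext => t; rewrite qdotE.
Qed.

Lemma is_derive_qdot (p q : R -> quat R) t p' q' :
  is_derive t (1 : R) p p' -> is_derive t (1 : R) q q' ->
  is_derive t (1 : R) (fun t => qdot (p t) (q t)) (qdot (p t) q' + qdot (q t) p').
Proof.
move=> dp dq; rewrite (_ : (fun _ => _) =
   (fun t => (p t).1.1.1) * (fun t => (q t).1.1.1) +
   (fun t => (p t).1.1.2) * (fun t => (q t).1.1.2) +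
   (fun t => (p t).1.2) * (fun t => (q t).1.2) +
   (fun t => (p t).2) * (fun t => (q t).2)); last first.
  by apply/funext => s; rewrite qdotE.
have dp1 := is_derive_fst dp; have dp11 := is_derive_fst dp1.
have dq1 := is_derive_fst dq; have dq11 := is_derive_fst dq1.
have := is_derive_fst dp11; have := is_derive_snd dp11.
have := is_derive_fst dq11; have := is_derive_snd dq11.
have := is_derive_snd dp1; have := is_derive_snd dq1.
have := is_derive_snd dp; have := is_derive_snd dq.
(* The eight coordinate derivatives enter the context as instances, from which the derivative of the
   sum of products is inferred. *)
move=> ? ? ? ? ? ? ? ?.
apply: is_derive_eq; rewrite !qdotE -![_ *: _]/(_ * _); ring.
Qed.

End QuaternionDot.

(** * Lyapunov estimates along one flow interval *)

Section ClosedLoopFlow.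
Context {R : realType}.
Variables k1 k2 delta : R.
Hypotheses (k1_gt0 : 0 < k1) (k2_gt0 : 0 < k2) (delta01 : 0 < delta < 1).
Implicit Types (q : dquat R) (y : state R) (x : R -> state R).

Local Notation velocity := (velocity k1 k2).
Local Notation flow_set := (flow_set (closed_loop k1 k2 delta)).

(** The inner product of the primary part with the pole [h] that the controller currently
    targets. *)
Definition align y : R := y.2 * qre y.1.1.

Definition dual_energy y : R := qdot y.1.2 y.1.2.

(** The quaternion in the second condition on unit dual quaternions is real and equals twice [qdot],
    so membership reduces to polynomial equations, which pass to limits. *)
Lemma state_spaceP y : state_space y <->
  [/\ qdot y.1.1 y.1.1 = 1, qdot y.1.1 y.1.2 = 0 & y.2 ^+ 2 = 1].
Proof.
have norm1 (p : quat R) : qnorm p = 1 <-> qdot p p = 1.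
  rewrite -qnorm_sqr; split => [->|/eqP]; first by rewrite expr1n.
  by rewrite sqrp_eq1 ?sqrtr_ge0 // => /eqP.
have orth (p p' : quat R) :
    qmul p (qconj p') + qmul p' (qconj p) = 0 <-> qdot p p' = 0.
  case: p p' => [[[a b] c] d] [[[a' b'] c'] d'] /=.
  split => [[+ _ _ _]|pp']; first lra.
  by congr (_, _, _, _) => /=; lra.
split => [[[/norm1 q1 /orth q2] h]|[/norm1 q1 /orth q2 h]].
  by split => //; case: h => ->; rewrite ?sqrrN expr1n.
split=> //=; move/eqP: h; rewrite sqrf_eq1 => /orP[]/eqP ->; by [right|left].
Qed.

Lemma align_sqr y : state_space y -> align y ^+ 2 = qre y.1.1 ^+ 2.
Proof. by move=> /state_spaceP[_ _ h]; rewrite exprMn h mul1r. Qed.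

Lemma qre_sqr_le1 y : state_space y -> qre y.1.1 ^+ 2 <= 1.
Proof.
move=> /state_spaceP[<- _ _]; rewrite qdotE -expr2 /qre -!addrA lerDl.
by rewrite !addr_ge0 // -expr2 sqr_ge0.
Qed.

Lemma align_le1 y : state_space y -> align y <= 1.
Proof.
move=> sy; rewrite (le_trans (ler_norm _)) // -(@expr_le1 _ 2) //.
by rewrite real_normK ?num_real // align_sqr // qre_sqr_le1.
Qed.

Lemma norm_align y : state_space y -> `|align y| = `|qre y.1.1|.
Proof. by move=> sy; rewrite -!sqrtr_sqr align_sqr. Qed.

(** The last factor is the squared norm of the imaginary part, so the flow drives the real part
    towards the sign of [h]. *)
Lemma qre_velocity q h :
  qre (velocity q h).1 = k1 * h / 2 * (qdot q.1 q.1 - qre q.1 ^+ 2).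
Proof.
case: q => [[[[a b] c] d] [[[a' b'] c'] d']]; rewrite /velocity /= /qre /=.
rewrite -![_ *: _]/(_ * _); field => //.
Qed.

(** Multiplying [q.2] by the imaginary primary control gives a quaternion orthogonal to [q.2], so
    only the dual control contributes. The last term vanishes on unit dual quaternions. *)
Lemma qdot_velocity q h : 2 * qdot q.2 (velocity q h).2 =
  - (k2 * qre q.1 ^+ 2 * qdot q.2 q.2) + k2 * qre q.1 * qre q.2 * qdot q.1 q.2.
Proof.
case: q => [[[[a b] c] d] [[[a' b'] c'] d']]; rewrite /velocity /= /qre /=.
rewrite -![_ *: _]/(_ * _); field => //.
Qed.

Definition flows_on x (s t : R) : Prop :=
  [/\ absolutely_continuous s t x,
      forall u, s < u < t -> flow_set (x u) &
      \forall u \ae lebesgue_measure, s < u < t ->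
        is_derive u (1 : R) x (velocity (x u).1 (x u).2, 0)].

Lemma flows_on_sub x s t s' t' : s <= s' -> t' <= t ->
  flows_on x s t -> flows_on x s' t'.
Proof.
move=> ss tt [acx xC dx]; split; first exact: absolutely_continuous_sub acx.
  by move=> u /andP[su ut]; apply: xC; rewrite (le_lt_trans ss) // (lt_le_trans ut).
apply: ae_imply dx => u + /andP[su ut].
by rewrite (le_lt_trans ss) // (lt_le_trans ut) // => /(_ isT).
Qed.

Lemma absolutely_continuous_align x s t :
  absolutely_continuous s t x -> absolutely_continuous s t (align \o x).
Proof.
move=> acx; apply: (@absolutely_continuousM _ (fun u => (x u).2)).
  exact: absolutely_continuous_snd acx.
by do 5 apply: absolutely_continuous_fst.
Qed.

(** The flow set is cut out by polynomial equations and a weak inequality, all of which extend to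
    the endpoints by continuity. *)
Lemma flows_on_flow_set x s t : s < t -> flows_on x s t ->
  flow_set (x s) /\ flow_set (x t).
Proof.
move=> st [acx xC _].
have ac1 := absolutely_continuous_fst acx.
have ac11 := absolutely_continuous_fst ac1.
have ac12 := absolutely_continuous_snd ac1.
have ac2 := absolutely_continuous_snd acx.
have aN := absolutely_continuous_endpoint_ge0 st
  (absolutely_continuousD (absolutely_continuous_align acx)
    (absolutely_continuous_cst delta _ _)).
(* An equation is treated as the two inequalities [0 <= f - c] and [0 <= - f + c]. *)
have eqc (f : R -> R) c : absolutely_continuous s t f ->
    (forall u, s < u < t -> f u = c) -> f s = c /\ f t = c.
  move=> acf fc.
  have [] := absolutely_continuous_endpoint_ge0 st
    (absolutely_continuousD acf (absolutely_continuous_cst (- c) _ _)).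
    by move=> u /fc uc; rewrite -[(_ + _) u]/(f u - c) uc subrr.
  have [] := absolutely_continuous_endpoint_ge0 st
    (absolutely_continuousD (absolutely_continuousN acf)
      (absolutely_continuous_cst c _ _)).
    by move=> u /fc uc; rewrite -[(_ + _) u]/(- f u + c) uc addNr.
  rewrite -![(_ + _) _]/(- f _ + c) -![(_ + _) _]/(f _ - c) => *; split; lra.
have [|n1 n2] := eqc _ 1 (absolutely_continuous_qdot ac11 ac11).
  by move=> u /xC[/state_spaceP[]].
have [|o1 o2] := eqc _ 0 (absolutely_continuous_qdot ac11 ac12).
  by move=> u /xC[/state_spaceP[]].
have [|h1 h2] := eqc _ 1 (absolutely_continuousM ac2 ac2).
  by move=> u /xC[/state_spaceP[]].
have [u /xC[_] /=|a1 a2] := aN; first by rewrite -[(_ + _) u]/(_ + _) /= /align; lra.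
split; split.
- by apply/state_spaceP.
- by move: a1; rewrite -[(_ + _) _]/(_ + _) /align /=; lra.
- by apply/state_spaceP.
- by move: a2; rewrite -[(_ + _) _]/(_ + _) /align /=; lra.
Qed.

(** With [a] the alignment, [1 - a] has derivative [- (k1 / 2 * (1 + a) * (1 - a))], and the flow
    set guarantees [1 + a >= 1 - delta]. *)
Lemma flows_on_align x s t : s < t -> flows_on x s t ->
  (1 - align (x t)) * (1 + k1 / 2 * (1 - delta) * (t - s)) <= 1 - align (x s).
Proof.
move=> st xst; have [acx xC dx] := xst; have [_ Ct] := flows_on_flow_set st xst.
apply: (@absolutely_continuous_decay _ (cst 1 - (align \o x))); first exact: ltW.
- by rewrite !mulr_ge0 ?invr_ge0 ?subr_ge0 ?ltW //; case/andP: delta01.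
- apply: absolutely_continuousD; first exact: absolutely_continuous_cst.
  exact/absolutely_continuousN/absolutely_continuous_align.
- move=> u /andP[su]; rewrite le_eqVlt -[(_ - _) u]/(1 - align (x u)) subr_ge0.
  move=> /predU1P[->|ut]; first by apply: align_le1; case: Ct.
  by apply: align_le1; have [|] := xC u; rewrite ?su.
apply: ae_imply dx => u du sut; have {}du := du sut.
have [sx xd] := xC _ sut.
have dq : is_derive u (1 : R) (fun s => qre (x s).1.1)
    (qre (velocity (x u).1 (x u).2).1).
  have := is_derive_fst du; do 4 move=> /is_derive_fst; exact.
have dh := is_derive_snd du.
have da := is_deriveB (is_derive_cst (1 : R) u 1) (is_deriveM dh dq).
eexists; first exact: da.
rewrite qre_velocity -![_ *: _]/(_ * _) sub0r lerN2.
have /state_spaceP[n1 _ h1] := sx; rewrite n1 mulr0 addr0.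
rewrite -[(_ - _) u]/(1 - align (x u)) -(align_sqr sx).
have -> : (x u).2 * (k1 * (x u).2 / 2 * (1 - align (x u) ^+ 2)) =
  k1 / 2 * (1 + align (x u)) * (1 - align (x u)) * (x u).2 ^+ 2 by field.
rewrite h1 mulr1 ler_wpM2r ?subr_ge0 ?align_le1 // ler_wpM2l //.
  by rewrite divr_ge0 // ltW.
by move: xd; rewrite /= -[_ * qre _]/(align (x u)); lra.
Qed.

Lemma flows_on_align_mono x s t : s < t -> flows_on x s t ->
  align (x s) <= align (x t).
Proof.
move=> st xst; have := flows_on_align st xst.
have [_ [/align_le1 + _]] := flows_on_flow_set st xst.
have : 0 <= k1 / 2 * (1 - delta) * (t - s).
  by rewrite !mulr_ge0 ?subr_ge0 ?divr_ge0 ?ltW //; case/andP: delta01.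
nra.
Qed.

(** Monotonicity keeps the alignment at least [delta], so the squared real part stays above
    [delta ^+ 2] and the energy decays at rate [k2 * delta ^+ 2] or faster. *)
Lemma flows_on_dual_energy x s t : s < t -> flows_on x s t -> delta <= align (x s) ->
  dual_energy (x t) * (1 + k2 * delta ^+ 2 * (t - s)) <= dual_energy (x s).
Proof.
move=> st xst xsd; have [acx xC dx] := xst.
have ac12 := absolutely_continuous_snd (absolutely_continuous_fst acx).
apply: (@absolutely_continuous_decay _ (dual_energy \o x)); first exact: ltW.
- by rewrite mulr_ge0 ?sqr_ge0 ?ltW.
- exact: absolutely_continuous_qdot.
- by move=> u _; exact: qdot_ge0.
apply: ae_imply dx => u du sut; have {}du := du sut.
have [su ut] := andP sut.
have [sx xd] := xC _ sut.
have dq := is_derive_snd (is_derive_fst du).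
eexists; first exact: (is_derive_qdot dq dq).
rewrite -mulr2n -mulr_natl qdot_velocity.
have /state_spaceP[n1 -> h1] := sx; rewrite mulr0 addr0 lerN2.
have ? := flows_on_align_mono su (flows_on_sub (lexx _) (ltW ut) xst).
rewrite /dual_energy /= ler_wpM2r ?qdot_ge0 // ler_wpM2l ?(ltW k2_gt0) //.
rewrite -(align_sqr sx) ler_sqr ?nnegrE; have /andP[d0 d1] := delta01; lra.
Qed.

End ClosedLoopFlow.

(** * Invariants of hybrid solutions *)

Section ClosedLoopSolutions.
Context {R : realType}.
Variables k1 k2 delta : R.
Hypotheses (k1_gt0 : 0 < k1) (k2_gt0 : 0 < k2) (delta01 : 0 < delta < 1).

Local Notation H := (closed_loop k1 k2 delta).
Local Notation velocity := (velocity k1 k2).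
Local Notation A := ([set dquat1; - dquat1] `*` [set -1; 1] : set (state R)).

Lemma solution_flows_on E (x : R -> nat -> state R) s t j :
  is_solution H E x -> E (s, j) -> E (t, j) -> s < t ->
  flows_on k1 k2 delta (x ^~ j) s t.
Proof.
move=> [domE acx xC dx _] Es Et st.
have itvE : `[s, t] `<=` time_slice E j.
  by move=> u /=; rewrite in_itv /=; exact: hybrid_time_domain_convex Es Et.
have intE u : s < u < t -> ((time_slice E j)°)%classic u.
  move=> sut; have : `]s, t[%classic u by rewrite /= in_itv.
  move: u {sut}; rewrite -[forall u, _]/(_ `<=` _).
  rewrite -open_subsetE; last exact: itv_open.
  by apply: subset_trans itvE; apply: subset_itv; rewrite bnd_simp.
split; first by apply: acx => //; exact: ltW.
  by move=> u /intE; exact: xC.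
by apply: ae_imply (dx j) => u du /intE /du[v ->].
Qed.

(** A zero real part would give alignment 0, which exceeds [- delta]; so in the jump set the sign is
    single-valued and the new [h] agrees with it. *)
Lemma jumpP y z : jump_set H y -> jump_map H y z ->
  [/\ z.1 = y.1, state_space z & align z = `|qre y.1.1|].
Proof.
move=> [[sq sh] yd] [/= zy]; rewrite /sgn_set.
have /andP[d0 _] := delta01.
have sz : z.2 = 1 \/ z.2 = -1 -> state_space z.
  by move=> z2; split; [rewrite zy|case: z2; [right|left]].
rewrite /align zy; have [n0 z2|n0 z2|n0] := ltgtP 0 (qre y.1.1).
- by rewrite z2 mul1r gtr0_norm //; split => //; apply: sz; left.
- by rewrite z2 mulN1r ltr0_norm //; split => //; apply: sz; right.
- by move: yd; rewrite -n0 mulr0; lra.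
Qed.

(** A solution living only at the origin of time is unconstrained and may start anywhere; any flow
    or jump forces its start into the state space. *)
Lemma solution_state_space E x : is_solution H E x ->
  forall t j, E (t, j) -> (t = 0 /\ j = 0%N) \/ state_space (x 0 0%N).
Proof.
move=> solx; have [domE _ _ _ xJ] := solx.
apply: hybrid_time_domain_ind => //; first by left.
  move=> s t j Es Et st [[s0 j0]|]; last by right.
  have [] := flows_on_flow_set st (solution_flows_on solx Es Et st).
  by rewrite s0 j0 => -[? _]; right.
move=> t j Et Ejt [[t0 j0]|]; last by right.
by have := xJ _ _ Et Ejt; rewrite t0 j0 => -[[? _]]; right.
Qed.

Let c1 := k1 / 2 * (1 - delta).
Let c2 := k2 * delta ^+ 2.

Let c1_gt0 : 0 < c1.
Proof. by rewrite !mulr_gt0 // subr_gt0; case/andP: delta01. Qed.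

Let c2_gt0 : 0 < c2.
Proof. by rewrite mulr_gt0 // exprn_gt0 //; case/andP: delta01. Qed.

(** Chains the decay on [[0, s]] with that on [[s, t]]: the product of the two growth factors
    exceeds [1 + c * t] by a nonnegative cross term. *)
Let growth_le (v c s t : R) : 0 <= v -> 0 <= c -> 0 <= s -> s <= t ->
  v * (1 + c * t) <= v * (1 + c * (t - s)) * (1 + c * s).
Proof.
move=> v0 c0 s0 st; rewrite -mulrA ler_wpM2l //.
have -> : (1 + c * (t - s)) * (1 + c * s) =
  1 + c * t + c * (t - s) * (c * s) by ring.
by rewrite lerDl !mulr_ge0 // subr_ge0.
Qed.

(** The reference value is the absolute real part of [y0] and not its alignment, because an initial
    jump may turn the latter into the former. *)
Definition decayed (y0 y : state R) (t : R) : Prop :=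
  [/\ state_space y, `|qre y0.1.1| <= align y,
      (1 - align y) * (1 + c1 * t) <= 1 - `|qre y0.1.1| &
      dual_energy y * (1 + c2 * t) <= dual_energy y0].

(** The start is a separate case: it may lie outside the state space or carry the wrong sign of
    [h]. *)
Lemma solution_decayed E x : is_solution H E x ->
  delta < `|qre (x 0 0%N).1.1| ->
  forall t j, E (t, j) ->
    0 <= t /\ ((t = 0 /\ j = 0%N) \/
               decayed (x 0 0%N) (x t j) t /\ (j <= 1)%N).
Proof.
move=> solx x0d; have [domE _ _ _ xJ] := solx; have /andP[d0 d1] := delta01.
apply: hybrid_time_domain_ind => //; first by split => //; left.
  move=> s t j Es Et st [s0 xs]; split; first exact: ltW (le_lt_trans s0 st).
  have flx := solution_flows_on solx Es Et st.
  have [[Cs1 Cs2] [Ct1 _]] := flows_on_flow_set st flx.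
  have [[_ as_ Vs Ws] j1] : decayed (x 0 0%N) (x s j) s /\ (j <= 1)%N.
    case: xs => [[s0' j0]|//].
    rewrite s0' j0 in Cs1 Cs2 *; split => //.
    (* A flow from the start needs alignment at least [- delta], which rules out the negative
       value. *)
    have al : `|qre (x 0 0%N).1.1| = align (x 0 0%N).
      move: x0d; rewrite -norm_align //.
      have [//|an] := ger0P (align (x 0 0%N)).
      by move: Cs2; rewrite /= -[_ * qre _]/(align (x 0 0%N)); lra.
    by split; rewrite ?al ?mulr0 ?addr0 ?mulr1.
  right; split => //; split => //.
  - exact: le_trans as_ (flows_on_align_mono k1_gt0 delta01 st flx).
  - apply: le_trans Vs.
    have V0 : 0 <= 1 - align (x t j) by rewrite subr_ge0 align_le1.
    apply: (le_trans (growth_le V0 (ltW c1_gt0) s0 (ltW st))).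
    rewrite ler_wpM2r ?addr_ge0 ?(mulr_ge0 (ltW c1_gt0) s0) //.
    exact: (flows_on_align k1_gt0 delta01 st flx).
  - apply: le_trans Ws.
    apply: (le_trans (growth_le (qdot_ge0 _) (ltW c2_gt0) s0 (ltW st))).
    rewrite ler_wpM2r ?addr_ge0 ?(mulr_ge0 (ltW c2_gt0) s0) //.
    by apply: (flows_on_dual_energy k1_gt0 k2_gt0 delta01 st flx); lra.
move=> t j Et Etj [t0 xt]; split => //; have [Jx Gx] := xJ _ _ Et Etj.
have [z1 sz az] := jumpP Jx Gx.
case: xt => [[t00 j0]|[[sx ax _ _] _]].
  rewrite t00 j0 in z1 sz az *; right; split => //.
  split; rewrite ?az ?mulr0 ?addr0 ?mulr1 //.
  by rewrite /dual_energy z1.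
(* Once decayed, the alignment exceeds [delta], so no further jump is possible. *)
by exfalso; have [_ /=] := Jx; rewrite -[_ * qre _]/(align (x t j)); lra.
Qed.

(** * Distance to the equilibrium set *)

Lemma state_dist_equilibrium y (s h : R) : state_space y -> s ^+ 2 = 1 ->
  state_dist y (((s, 0, 0, 0), 0), h) =
  Num.sqrt (2 - 2 * (s * qre y.1.1) + dual_energy y + (y.2 - h) ^+ 2).
Proof.
move=> /state_spaceP[n1 _ _] s1; rewrite /state_dist !qnorm_sqr.
congr (Num.sqrt (_ + _ + _)); last by rewrite subr0.
case: y n1 => [[[[[a b] c] d] q'] h'] n1; rewrite qdotE /qre /=; rewrite /= in n1.
transitivity (s ^+ 2 + (a * a + b * b + c * c + d * d) - 2 * (s * a)).
  by ring.
by rewrite s1 n1; ring.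
Qed.

Lemma oppr_dquat1 : - dquat1 = ((-1, 0, 0, 0), 0) :> dquat R.
Proof. by congr (_, _, _, _, _); rewrite /= oppr0. Qed.

(** The nearest equilibrium keeps [h] and takes the sign of the real part, with 1 chosen when the
    real part is 0. *)
Lemma dist_equilibria y : state_space y ->
  dist_set state_dist A y = Num.sqrt (2 - 2 * `|qre y.1.1| + dual_energy y).
Proof.
move=> sy; have [_ hy] := sy.
have distA a : A a ->
    Num.sqrt (2 - 2 * `|qre y.1.1| + dual_energy y) <= state_dist y a.
  case: a => q h [/= qA _].
  have [s [s1 sq ->]] : exists s : R, [/\ s ^+ 2 = 1, s * qre y.1.1 <= `|qre y.1.1| &
      q = ((s, 0, 0, 0), 0)].
    case: qA => ->; [exists 1|exists (-1)].
      by rewrite expr1n mul1r ler_norm.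
    by rewrite sqrrN expr1n mulN1r -normrN ler_norm oppr_dquat1.
  rewrite state_dist_equilibrium // ler_wsqrtr //.
  by have := sqr_ge0 (y.2 - h); lra.
apply/eqP; rewrite eq_le; apply/andP; split; last first.
  apply: lb_le_inf; last by move=> _ [a Aa <-]; exact: distA.
  by exists (state_dist y (dquat1, 1)), (dquat1, 1) => //; split; [left|right].
apply: ge_inf.
  exists (Num.sqrt (2 - 2 * `|qre y.1.1| + dual_energy y)) => _ [a Aa <-].
  exact: distA.
pose s : R := if 0 <= qre y.1.1 then 1 else -1.
exists (((s, 0, 0, 0), 0), y.2).
  split => //=; rewrite /s; case: ifP => _; first by left.
  by right; rewrite oppr_dquat1.
rewrite state_dist_equilibrium //; last first.
  by rewrite /s; case: ifP; rewrite ?sqrrN expr1n.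
by rewrite subrr expr0n addr0 /s; case: ger0P => _; rewrite ?mul1r ?mulN1r.
Qed.

(** * Stability and attractivity *)

Lemma decayed_bounds y0 y t : decayed y0 y t -> 0 <= t ->
  `|qre y0.1.1| <= `|qre y.1.1| /\ dual_energy y <= dual_energy y0.
Proof.
move=> [sy ay _ Wy] t0; split.
  by rewrite -(norm_align sy) (le_trans ay) // ler_norm.
apply: le_trans Wy; rewrite ler_peMr ?qdot_ge0 // lerDl mulr_ge0 // ltW //.
Qed.

Lemma closed_loop_stable : stable state_dist H A.
Proof.
move=> e e0; have /andP[d0 d1] := delta01.
(* A distance of at most [1 - delta] makes the absolute real part at least
   [1 - (1 - delta) ^+ 2 / 2], which exceeds [delta]. *)
exists (Num.min e (1 - delta)); first by rewrite lt_min e0 subr_gt0.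
move=> E x solx; rewrite le_min => /andP[xe xd] t j Et.
have [[-> ->] //|sx0] := solution_state_space solx Et.
move: xe xd; rewrite dist_equilibria // => xe xd.
have x0d : delta < `|qre (x 0 0%N).1.1|.
  have dE : 1 - delta = Num.sqrt ((1 - delta) ^+ 2).
    by rewrite sqrtr_sqr gtr0_norm // subr_gt0.
  move: xd; rewrite dE.
  rewrite ler_sqrt ?sqr_ge0 //; have := qdot_ge0 (x 0 0%N).1.2.
  by rewrite -/(dual_energy _); nra.
have [t0 [[-> ->]|[xt _]]] := solution_decayed solx x0d Et.
  by rewrite dist_equilibria.
have [st _ _ _] := xt; have [? ?] := decayed_bounds xt t0.
rewrite dist_equilibria // (le_trans _ xe) // ler_wsqrtr //; lra.
Qed.

(** Relates the maximum norm, in which boundedness is stated, to the energy, through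
    [|r| <= 1 + r ^+ 2] in each coordinate. *)
Lemma norm_quat_le (p : quat R) : `|p| <= 1 + qdot p p.
Proof.
have sq (r : R) : `|r| <= 1 + r ^+ 2.
  by rewrite -(real_normK (num_real r)); nra.
rewrite !prod_normE !ge_max qdotE -!expr2.
have := sqr_ge0 p.1.1.1; have := sqr_ge0 p.1.1.2.
have := sqr_ge0 p.1.2; have := sqr_ge0 p.2.
have := sq p.1.1.1; have := sq p.1.1.2; have := sq p.1.2; have := sq p.2.
by move=> *; apply/andP; split; [apply/andP; split; [apply/andP; split|]|]; lra.
Qed.

Lemma norm_state_le (y : state R) : state_space y -> `|y| <= 2 + dual_energy y.
Proof.
move=> /state_spaceP[n1 _ h1].
have := norm_quat_le y.1.1; have := norm_quat_le y.1.2.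
have : `|y.2| = 1.
  by apply/eqP; rewrite -(@eqrXn2 _ 2) // real_normK ?num_real ?h1 ?expr1n.
have := qdot_ge0 y.1.2; rewrite !prod_normE !ge_max n1 -/(dual_energy _).
by move=> *; apply/andP; split; [apply/andP; split|]; lra.
Qed.

Let continuous_fst_comp (T U V : topologicalType) (f : T -> U * V) a :
  {for a, continuous f} -> {for a, continuous (fun b => (f b).1)}.
Proof. by move=> cf; apply: (continuous_comp cf); exact: cvg_fst. Qed.

Lemma closed_loop_attractive : attractive state_dist H A.
Proof.
have /andP[d0 d1] := delta01.
(* The value of [h] is left free: a state with [h] opposed to the real part has alignment below
   [- delta], so it cannot flow and can only jump. *)
exists [set y : state R | delta < `|qre y.1.1|].
  move=> [q h] [/= qA _].
  have cont : {for (q, h), continuous (fun y : state R => `|qre y.1.1|)}.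
    apply: continuous_comp; last exact: norm_continuous.
    by do 5 apply: continuous_fst_comp; exact: cvg_id.
  apply: (cvgr_gt (`|qre q.1|)) cont _ _.
  by case: qA => ->; rewrite ?oppr_dquat1 /qre /= ?normrN normr1.
move=> E x solx /= x0d; have dec := solution_decayed solx x0d.
set W0 := dual_energy (x 0 0%N); have W0_ge0 : 0 <= W0 by exact: qdot_ge0.
split.
  (* The initial state is bounded separately, as it may lie outside the state space. *)
  exists (Num.max (2 + W0) `|x 0 0%N|); split; first exact: num_real.
  move=> M; rewrite gt_max => /andP[WM xM] _ [[t j] Et <-].
  have [t0 [[-> ->]|[xt _]]] := dec _ _ Et; first exact: ltW.
  have [st _ _ _] := xt; have [_ WW] := decayed_bounds xt t0.
  by apply: (le_trans (norm_state_le st)); move: WW WM; rewrite /= -/W0; lra.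
move=> _ e e0; pose c := Num.min c1 c2.
have c_gt0 : 0 < c by rewrite lt_min c1_gt0 c2_gt0.
have ce : 0 < c * e ^+ 2 by rewrite mulr_gt0 ?exprn_gt0.
(* The summand 1 absorbs the single possible jump. The squared distance times [1 + c * t] is at most
   [2 + W0], which for such [t] is at most [e ^+ 2 * (1 + c * t)]. *)
exists ((2 + W0) / (c * e ^+ 2) + 1) => t j Et Ttj.
have K0 : 0 <= (2 + W0) / (c * e ^+ 2) by rewrite divr_ge0 ?ltW //; lra.
have [t0 [[t00 j0]|[xt j1]]] := dec _ _ Et.
  by exfalso; move: Ttj; rewrite t00 j0; lra.
have tK : (2 + W0) <= t * (c * e ^+ 2).
  rewrite -ler_pdivrMr //; have : (j%:R : R) <= 1 by rewrite -[1]/(1%:R) ler_nat.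
  lra.
have [st ax Vx Wx] := xt.
have eE : e = Num.sqrt (e ^+ 2) by rewrite sqrtr_sqr gtr0_norm.
rewrite dist_equilibria // eE ler_wsqrtr //.
have ct : 0 <= c * t by rewrite mulr_ge0 // ltW.
have ct1 : 0 < 1 + c * t by lra.
rewrite -(ler_pM2r ct1).
have V0 : 0 <= 1 - align (x t j) by rewrite subr_ge0 align_le1.
have := qdot_ge0 (x t j).1.2; rewrite -/(dual_energy _) => Wt.
have cc1 : (1 - align (x t j)) * (1 + c * t) <= 1 - `|qre (x 0 0%N).1.1|.
  by apply: le_trans Vx; rewrite ler_wpM2l // lerD2l ler_wpM2r // ge_min lexx.
have cc2 : dual_energy (x t j) * (1 + c * t) <= W0.
  by apply: le_trans Wx; rewrite ler_wpM2l // lerD2l ler_wpM2r // ge_min lexx orbT.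
have cc3 : (1 - `|qre (x t j).1.1|) * (1 + c * t) <=
    (1 - align (x t j)) * (1 + c * t).
  by rewrite ler_wpM2r ?(ltW ct1) // lerD2l lerN2 -(norm_align st) ler_norm.
have cc4 : t * (c * e ^+ 2) <= e ^+ 2 * (1 + c * t).
  by have := sqr_ge0 e; rewrite mulrDr; nra.
have := normr_ge0 (qre (x 0 0%N).1.1).
rewrite mulrDl (_ : 2 - 2 * _ = 2 * (1 - `|qre (x t j).1.1|)); last by ring.
by rewrite -mulrA; lra.
Qed.

(** * Equilibrium points and compactness *)

Lemma qdot_eq0 (p : quat R) : qdot p p = 0 -> p = 0.
Proof.
case: p => [[[a b] c] d] /= h.
have := sqr_ge0 a; have := sqr_ge0 b; have := sqr_ge0 c; have := sqr_ge0 d.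
rewrite !expr2 => *.
have z (r : R) : r * r <= 0 -> r = 0.
  by rewrite -expr2 => rr; apply/eqP; rewrite -sqrf_eq0 eq_le rr sqr_ge0.
by rewrite (z a) 1?(z b) 1?(z c) 1?(z d) //; lra.
Qed.

(** A vanishing rate of the real part forces its square to be 1, hence a zero imaginary part; the
    vanishing energy rate then kills the dual part. *)
Lemma equilibrium_pointsE : equilibrium_points k1 k2 delta = [set dquat1; - dquat1].
Proof.
have /andP[d0 d1] := delta01.
apply/seteqP; split => [q [h [[sq _] vq]]|q qA].
  have /state_spaceP[/= n1 o1 h1] := sq.
  have h0 : h != 0 by apply: contra_eq_neq h1 => ->; rewrite expr0n eq_sym oner_eq0.
  have e1 : qre q.1 ^+ 2 = 1.
    have := qre_velocity k1 k2 q h; rewrite vq n1 /= => /eqP.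
    rewrite eq_sym !mulf_eq0 invr_eq0 (gt_eqF k1_gt0) (negbTE h0) pnatr_eq0 /=.
    by rewrite subr_eq0 => /eqP.
  have q20 : q.2 = 0.
    apply: qdot_eq0; have := qdot_velocity k1 k2 q h.
    rewrite vq o1 e1 mulr1 mulr0 addr0 qdotE /= !mulr0 !addr0 mulr0 => /eqP.
    by rewrite eq_sym oppr_eq0 mulf_eq0 gt_eqF // => /eqP.
  case: q n1 e1 q20 {sq vq o1} => [[[[a b] c] d] q'] /= n1; rewrite /qre /= => e1 ->.
  have [b0 c0 d0'] : [/\ b = 0, c = 0 & d = 0].
    have /qdot_eq0[-> -> ->//] : qdot (0, b, c, d) (0, b, c, d) = 0.
    by rewrite /= ; move: n1 e1; rewrite expr2; lra.
  rewrite b0 c0 d0'; move/eqP: e1; rewrite sqrf_eq1 => /orP[]/eqP ->.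
    by left.
  right.
  by rewrite /= oppr_dquat1.
have [s [s1 ->]] : exists s : R, [/\ s ^+ 2 = 1 & q = ((s, 0, 0, 0), 0)].
  case: qA => ->; [exists 1|exists (-1)]; rewrite ?sqrrN expr1n //.
  by rewrite oppr_dquat1.
(* Taking [h = s] gives alignment 1, which places the point in the flow set. *)
exists s; split.
  split => /=; last by rewrite /qre /= -expr2 s1; lra.
  by apply/state_spaceP; split => //=; [rewrite -s1; ring|ring].
by congr (_, _, _, _, (_, _, _, _)); rewrite /= -![_ *: _]/(_ * _); ring.
Qed.

Lemma equilibria_compact : compact A.
Proof.
by apply: compact_setX; apply: compactU; exact: compact_set1.
Qed.

End ClosedLoopSolutions.

Theorem theorem3 (R : realType) (k1 k2 delta : R)
  (hk1 : 0 < k1) (hk2 : 0 < k2) (hdelta : 0 < delta < 1) :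
  equilibrium_points k1 k2 delta = [set dquat1; - dquat1] /\
  asymptotically_stable state_dist (closed_loop k1 k2 delta)
    ([set dquat1; - dquat1] `*` [set -1; 1]).
Proof.
split; first exact: equilibrium_pointsE.
split; [exact: equilibria_compact|exact: closed_loop_stable|].
exact: closed_loop_attractive.
Qed.
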